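(* Let $p$ be a prime with $p\equiv 3 \pmod 4$ and let $G_p$ be the quadratic-residue tournament of order $p$. Then $\mathrm{TD}_{min}(\mathcal{C}(G_p)) > \frac{1}{2}\log(p) - \log\log(p) - 1$.
   Context: $\log$ denotes the base-2 logarithm. A tournament $G=(V,E)$ is a complete oriented graph: for every two distinct $x,y\in V$ exactly one of $(x,y),(y,x)$ lies in $E$. For a prime $p\equiv 3\pmod 4$, the quadratic-residue tournament of order $p$ has $V=\{0,1,\ldots,p-1\}$ and $E=\{(x,y)\in V\times V: x-y \text{ is a (nonzero) quadratic residue modulo } p\}$. For a tournament $G=(V,E)$, its concept class is $\mathcal{C}(G)=\{C_x:x\in V\}$ over domain $V$, where $C_x=\{a\in V:(x,a)\in E\}$. For a concept class $\mathcal{C}$ over a domain $\mathcal{X}$, a teaching set for $C\in\mathcal{C}$ is a set $D\subseteq\mathcal{X}$ such that for every $C'\in\mathcal{C}\setminus\{C\}$ some $x\in D$ has $C(x)\ne C'(x)$; $\mathrm{TD}(C,\mathcal{C})$ is the minimum size of a teaching set for $C$, and $\mathrm{TD}_{min}(\mathcal{C})=\min_{C\in\mathcal{C}}\mathrm{TD}(C,\mathcal{C})$. *)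

(* Defs.v *)
From mathcomp Require Import all_boot all_order all_algebra all_field.
From mathcomp Require Import all_reals exp.
Set Implicit Arguments.
Unset Strict Implicit.
Unset Printing Implicit Defensive.
Import Order.TTheory GRing.Theory Num.Theory.
Local Open Scope ring_scope.

Definition log2 (R : realType) (x : R) : R := ln x / ln 2.

Section Teaching.
Variable X : finType.
Implicit Types (CC : {set {set X}}) (C D : {set X}).

(* A concept C is a subset of the domain X; C(x) is the truth value of x \in C. *)
Definition teaching_set CC C D : bool :=
  [forall C' in CC :\ C, exists x in D, (x \in C) != (x \in C')].

(* [set: X] is a teaching set for every concept (teaching_setT), so the seed
   #|X| of this minimum never affects its value. *)
Definition TD CC C : nat :=
  \big[minn/#|X|]_(D : {set X} | teaching_set CC C D) #|D|.

(* TD CC C <= #|X| (TD_le), so the seed only matters for the empty class. *)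
Definition TDmin CC : nat := \big[minn/#|X|]_(C in CC) TD CC C.

Lemma teaching_setT CC C : teaching_set CC C [set: X].
Proof.
apply/forall_inP => C' /setD1P[neC _]; apply: contraNT neC => /existsPn h.
by apply/eqP/setP => x; move: (h x); rewrite in_setT negbK => /eqP.
Qed.

Lemma TD_le CC C : (TD CC C <= #|X|)%N.
Proof. by rewrite /TD; elim/big_ind: _ => // [x y hx hy|D _]; [rewrite geq_min hx | exact: max_card]. Qed.

End Teaching.

Section Tournament.
Variable V : finType.

Definition is_tournament (e : rel V) : Prop :=
  irreflexive e /\ forall x y, x != y -> e x y (+) e y x.

Definition out_nbrs (e : rel V) (x : V) : {set V} := [set a | e x a].

Definition concept_class (e : rel V) : {set {set V}} :=
  [set out_nbrs e x | x : V].

End Tournament.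

Definition quad_residue (p : nat) (a : int) : bool :=
  ~~ (p %| a)%Z && [exists z : 'I_p, ((z : nat)%:Z ^+ 2 == a %[mod p])%Z].

Definition qr_edge (p : nat) : rel 'I_p :=
  fun x y => quad_residue p ((x : nat)%:Z - (y : nat)%:Z).
Arguments qr_edge p : clear implicits.

Lemma quad_residueE (p : nat) (a : int) : prime p ->
  quad_residue p a = (a%:~R != 0 :> 'F_p) && [exists z : 'F_p, z ^+ 2 == a%:~R].
Proof.
move=> pp; have ch := pchar_Fp pp.
rewrite /quad_residue (dvdz_pcharf ch); congr (_ && _).
have E (m : int) : (m == a %[mod p])%Z = (m%:~R == a%:~R :> 'F_p).
  by rewrite eqz_mod_dvd (dvdz_pcharf ch) rmorphB subr_eq0.
apply/existsP/existsP => -[z].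
  by rewrite E rmorphXn => h; exists ((z : nat)%:Z)%:~R.
move=> h; have zp : (z < p)%N by rewrite -[X in (_ < X)%N](Fp_cast pp).
by exists (Ordinal zp); rewrite E rmorphXn /= -pmulrn natr_Zp.
Qed.

Lemma qr_edge_tournament (p : nat) :
  prime p -> p = 3 %[mod 4] -> is_tournament (qr_edge p).
Proof.
move=> pp p3; split=> [x|x y nxy].
  by rewrite /qr_edge subrr /quad_residue dvdz0.
rewrite /qr_edge -[(y : nat)%:Z - _]opprB !quad_residueE //.
have a0 : ((x : nat)%:Z - (y : nat)%:Z)%:~R != 0 :> 'F_p.
  by rewrite -(dvdz_pcharf (pchar_Fp pp)) -eqz_mod_dvd !modz_nat !modn_small //.
rewrite rmorphN oppr_eq0 a0 /=; move: (_%:~R) a0 => {x y nxy} /= a a0.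
pose k := (p %/ 4)%N.
have pk : p = (4 * k + 3)%N.
  by rewrite {1}(divn_eq p 4) p3 mulnC.
have fermat (b : 'F_p) : b != 0 -> b ^+ (2 * (2 * k + 1)) = 1.
  move=> b0; apply: (mulfI b0); rewrite mulr1 -exprS.
  rewrite -[RHS](expf_card b) card_Fp //; congr (_ ^+ _).
  by rewrite [RHS]pk mulnDr mulnA -addnS.
have m1 : (-1 : 'F_p) != 1.
  rewrite eq_sym -addr_eq0 -(natrD _ 1 1) -(dvdn_pcharf (pchar_Fp pp)).
  by apply/negP => hd; have := @dvdn_leq p 2 isT hd; rewrite pk addnC.
have [/existsP[z /eqP hz]|nz] := boolP [exists z : 'F_p, z ^+ 2 == a].
  apply/negP => /existsP[w /eqP hw].
  have w0 : w != 0.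
    by apply: contraNneq a0 => w0; rewrite -oppr_eq0 -hw w0 expr0n.
  have z0 : z != 0.
    by apply: contraNneq a0 => z0; rewrite -hz z0 expr0n.
  have := fermat _ w0; rewrite exprM hw -hz exprNn -exprM fermat // mulr1.
  by rewrite addn1 exprS exprM sqrrN expr1n expr1n mulr1 => /eqP; apply/negP.
apply/existsP; exists (a ^+ k.+1).
have hs : (a ^+ (2 * k + 1)) ^+ 2 == 1 by rewrite -exprM mulnC fermat.
have hq : (a ^+ k.+1) ^+ 2 = a ^+ (2 * k + 1) * a.
  by rewrite -exprM -exprSr; congr (_ ^+ _); rewrite mulnC mulnS addn1 add2n.
move: hs; rewrite sqrf_eq1 => /orP[]/eqP hs; rewrite hq hs ?mulN1r ?eqxx //.
by case/existsP: nz; exists (a ^+ k.+1); rewrite hq hs mul1r.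
Qed.

(* Main.v *)
Require Import Defs.
From mathcomp Require Import all_boot all_order all_algebra.
From mathcomp Require Import all_reals.
From mathcomp Require Import finfield exp zify ring lra.
Import Order.TTheory GRing.Theory Num.Theory.
Local Open Scope ring_scope.

(* A set D of k vertices teaches no concept C_x as soon as some y <> x realises
   the pattern of x on D, that is, the values of the quadratic character at y - a
   for a in D are the prescribed signs.  Expanding the product of the
   1 + eps_a chi(y - a) and summing over y counts such y up to the character sums
   of the 2^k - 1 products of distinct linear factors, so a Weil-type bound
   O(d sqrt p) suffices, and the constant is not critical: a small teaching set
   gives 16 ((k + 2) 2^k)^2 <= p.

   The character sum bound is obtained by Stepanov's method.  With g = f^((p-1)/2),
   an auxiliary polynomial
     F = f^l * sum_(j < J) (r_j + s_j g) (X^p - c)^j,   f(c) <> 0,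
   with r_j, s_j of degree less than about (p - d)/2, vanishes to order l at every
   y with g(y) = v under l (b + l d + J) linear conditions, fewer than the 2 J b
   unknown coefficients.  Comparing degrees with l = 2h near sqrt p, J = h + d + 1
   gives at most p/2 + O(d sqrt p) points for v = 1 and for v = -1. *)

(** * Stepanov's method *)

(** In the Taylor expansion of [P] at [x], the coefficient of index [i] is the [i]-th derivative
    divided by [i!], and [i!] is invertible for [i < l <= p]. *)
Lemma dvdp_exp_derivn (F : fieldType) (p l : nat) (P : {poly F}) (x : F) :
  p \in [pchar F] -> (l <= p)%N ->
  (forall k, (k < l)%N -> P^`(k).[x] = 0) -> ('X - x%:P) ^+ l %| P.
Proof.
move=> ch lp hk.
have -> : P = \sum_(i < size P) (P^`N(i).[x])%:P * ('X - x%:P) ^+ i.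
  have {1}-> : P = (map_poly polyC P).[x%:P + ('X - x%:P)].
    by rewrite addrC subrK -/(P \Po 'X) comp_polyXr.
  rewrite nderiv_taylor; last exact: mulrC.
  rewrite size_map_polyC; apply: eq_bigr => i _.
  by rewrite nderivn_map horner_map.
elim/big_ind: _ => [|u v|i _]; [exact: dvdp0 | exact: dvdp_add |].
have [il|li] := ltnP i l; last first.
  by rewrite dvdp_mull // dvdp_exp2l.
have fact_n0 : (i`!)%:R != 0 :> F.
  rewrite -(dvdn_pcharf ch) -prime_coprime ?(pcharf_prime ch) //.
  rewrite fact_prod big_seq_cond; elim/big_ind: _ => [|u v|m].
  - by rewrite coprimen1.
  - by rewrite coprimeMr => -> ->.
  rewrite andbT mem_index_iota => /andP[m0 mi].
  rewrite prime_coprime ?(pcharf_prime ch) // gtnNdvd //.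
  exact: leq_ltn_trans (leq_trans il lp).
have := hk i il; rewrite nderivn_def hornerMn -mulr_natr.
by move/eqP; rewrite mulf_eq0 (negPf fact_n0) orbF => /eqP->; rewrite mul0r dvdp0.
Qed.

Lemma card_multiple_roots (F : fieldType) (l : nat) (P : {poly F}) (s : seq F) :
  P != 0 -> uniq s -> (forall y, y \in s -> ('X - y%:P) ^+ l %| P) ->
  (l * size s < size P)%N.
Proof.
move=> P0 us hs; have : (\prod_(y <- s) ('X - y%:P)) ^+ l %| P.
  elim: s us hs => [|y s IHs] /=; first by rewrite big_nil expr1n dvd1p.
  move=> /andP[ys us] hs; rewrite big_cons exprMn Gauss_dvdp.
    rewrite hs ?mem_head // IHs // => z zs; apply: hs; exact: mem_behead.
  by rewrite coprimep_expl // coprimep_expr // coprimep_sym coprimep_XsubC root_prod_XsubC.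
move/dvdp_leq => /(_ P0); apply: leq_trans.
rewrite -[X in (_ <= X)%N]prednK; last first.
  by rewrite size_poly_gt0 expf_neq0 // monic_neq0 // monic_prod_XsubC.
by rewrite size_exp size_prod_XsubC /= mulnC.
Qed.

(** For [k <= m] this is the cofactor of [f ^+ (m - k)] in the [k]-th derivative of [f ^+ m * r].
    Its degree grows with [k] but not with [m], so the huge exponent [l + p./2] costs nothing. *)
Fixpoint twisted_deriv (R : comNzRingType) (f : {poly R}) (m k : nat) (r : {poly R}) :=
  if k is k'.+1 then
    let u := twisted_deriv R f m k' r in f^`() * u *+ (m - k') + f * u^`()
  else r.

Lemma twisted_derivE (R : comNzRingType) (f Q : {poly R}) (m k : nat) (r : {poly R}) :
  (k <= m)%N -> Q^`() = 0 ->
  (f ^+ m * r * Q)^`(k) = f ^+ (m - k) * twisted_deriv R f m k r * Q.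
Proof.
move=> km Q0; elim: k km => [|k IHk] km; first by rewrite subn0.
rewrite derivnS IHk; last exact: ltnW.
rewrite !derivM Q0 mulr0 addr0 deriv_exp /=.
have -> : (m - k = (m - k.+1).+1)%N by rewrite -subSn.
rewrite exprS /=; move: (twisted_deriv _ _ _ _ _) (f ^+ _) (f^`()) => u v w.
rewrite mulrDl mulrDr mulrDl mulrnAl mulrnAl mulrnAr mulrnAl.
by congr (_ *+ _ + _); ring.
Qed.

Lemma twisted_derivB (R : comNzRingType) (f : {poly R}) (m k : nat) :
  {morph twisted_deriv R f m k : r s / r - s}.
Proof.
move=> r s; elim: k => //= k ->; rewrite derivB mulrBr mulrnBl mulrBr opprD addrACA; apply: erefl.
Qed.

Lemma size_twisted_deriv (R : comNzRingType) (f r : {poly R}) (m k d : nat) :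
  (size f <= d.+1)%N -> (size (twisted_deriv R f m k r) <= size r + k * d)%N.
Proof.
move=> fd; elim: k => [|k IHk] /=; first by rewrite addn0.
move: (twisted_deriv _ _ _ _ _) IHk => u hu.
have sf' : (size f^`() <= d)%N.
  have [->|f0] := eqVneq f 0; first by rewrite deriv0 size_poly0.
  by rewrite -ltnS (leq_trans (lt_size_deriv f0)).
have [->|u0] := eqVneq u 0; first by rewrite deriv0 !mulr0 mul0rn addr0 size_poly0.
have u1 : (size u^`() < size u)%N := lt_size_deriv u0.
apply: leq_trans (size_polyD _ _) _; rewrite geq_max; apply/andP; split.
  rewrite -scaler_nat; apply: leq_trans (size_scale_leq _ _) _.
  apply: leq_trans (size_polyMleq _ _) _.
  by move: sf' hu; move: (size _) (size _) (size _); lia.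
apply: leq_trans (size_polyMleq _ _) _.
by move: fd hu u1; move: (size _) (size _) (size _) (size _); lia.
Qed.

Lemma expr_Fp (p : nat) (c : 'F_p) : prime p -> c ^+ p = c.
Proof. by move=> hp; have := expf_card c; rewrite card_Fp. Qed.

Lemma exprp_comp_Fp (p : nat) (f : {poly 'F_p}) :
  prime p -> f ^+ p = f \Po 'X^p.
Proof.
move=> hp; have ch : [pchar {poly 'F_p}].-nat p.
  by rewrite pnatE // inE hp -polyC_natr polyC_eq0 (pcharf0 (pchar_Fp hp)) eqxx.
elim/poly_ind: f => [|f c IHf]; first by rewrite comp_poly0 expr0n gtn_eqF ?prime_gt0.
rewrite comp_polyD comp_polyM comp_polyX comp_polyC -IHf.
rewrite exprDn_pchar // exprMn -rmorphXn /=.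
by rewrite expr_Fp.
Qed.

(** This makes the auxiliary polynomial nonzero: a relation modulo ['X^p - c%:P] would make
    [f * r ^+ 2] a scalar multiple of [s ^+ 2], which parity of multiplicities at [a] forbids. *)
Lemma stepanov_independence (p : nat) (f r s : {poly 'F_p}) (a c : 'F_p) (b : nat) :
  prime p -> odd p -> (0 < b)%N -> mup a f = 1%N -> f.[c] != 0 ->
  (b.*2 + size f <= p.+2)%N -> (size r <= b)%N -> (size s <= b)%N ->
  'X^p - c%:P %| r + s * f ^+ p./2 -> r = 0 /\ s = 0.
Proof.
move=> hp op b0 fa fc hb rb sb Qdvd.
have f0 : f != 0 by apply: contraNneq fc => ->; rewrite horner0.
(* f (r + s g) (r - s g) = f r^2 - s^2 f^p, and f^p = f(X^p) is f(c) modulo X^p - c. *)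
have dvd1 : 'X^p - c%:P %| f * r ^+ 2 - s ^+ 2 * f ^+ p.
  have -> : f * r ^+ 2 - s ^+ 2 * f ^+ p =
            (r + s * f ^+ p./2) * (f * (r - s * f ^+ p./2)).
    have -> : f ^+ p = f * (f ^+ p./2) ^+ 2.
      rewrite -exprM -exprS; congr (_ ^+ _).
      by have := odd_double_half p; rewrite op; lia.
    by ring.
  exact: dvdp_mulr.
have dvd2 : 'X^p - c%:P %| f ^+ p - (f.[c])%:P.
  have /factor_theorem[q hq] : root (f - (f.[c])%:P) c.
    by rewrite rootE !hornerE subrr.
  have -> : f ^+ p - (f.[c])%:P = (f - (f.[c])%:P) \Po 'X^p.
    by rewrite comp_polyB comp_polyC exprp_comp_Fp.
  rewrite hq comp_polyM comp_polyB comp_polyX comp_polyC; exact: dvdp_mull.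
(* Both terms have size at most [p], while the modulus has size [p.+1], so the congruence is an
   equality. *)
have eq0 : f * r ^+ 2 - f.[c] *: s ^+ 2 = 0.
  apply/eqP; apply: contraTT isT => n0.
  have : 'X^p - c%:P %| f * r ^+ 2 - f.[c] *: s ^+ 2.
    have := dvdp_add dvd1 (dvdp_mull (s ^+ 2) dvd2).
    rewrite mulrBr addrA subrK mulrC -mul_polyC [s ^+ 2 * _]mulrC.
    by rewrite [r ^+ 2 * f]mulrC.
  move=> /dvdp_leq => /(_ n0); rewrite size_XnsubC ?prime_gt0 //.
  apply: contraTT => _; rewrite -leqNgt.
  apply: leq_trans (size_polyD _ _) _; rewrite geq_max size_polyN; apply/andP; split.
    apply: leq_trans (size_polyMleq _ _) _.
    have := size_exp_leq r 2.
    by move: rb hb; move: (size r) (size f) (size (r ^+ 2)); lia.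
  apply: leq_trans (size_scale_leq _ _) _; have := size_exp_leq s 2.
  have : (0 < size f)%N by rewrite size_poly_gt0.
  by move: sb hb; move: (size s) (size f) (size (s ^+ 2)); lia.
have {}eq0 : f * r ^+ 2 = f.[c] *: s ^+ 2 by apply/eqP; rewrite -subr_eq0 eq0.
have [s0|s0] := eqVneq s 0.
  move: eq0; rewrite s0 expr0n scaler0 => /eqP.
  by rewrite mulf_eq0 (negPf f0) expf_eq0 /= => /eqP.
have r0 : r != 0.
  apply: contraNneq s0 => r0; move/esym/eqP: eq0.
  by rewrite r0 expr0n mulr0 scaler_eq0 (negPf fc) expf_eq0.
(* The simple root a of f has odd multiplicity on the left, even on the right. *)
have mup2 (q : {poly 'F_p}) : q != 0 -> mup a (q ^+ 2) = (mup a q + mup a q)%N.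
  by move=> q0; rewrite expr2 mupM.
move: (congr1 (mup a) eq0); rewrite -mul_polyC.
have cN : ~~ root (f.[c])%:P a by rewrite rootE hornerC.
rewrite (mupMr _ cN) mup2 // (mupM _ f0 (expf_neq0 2 r0)) mup2 // fa.
by move/(congr1 odd); rewrite !addnn /= !odd_double.
Qed.

(* At a point [y] with [y ^+ p = y] and [f ^+ p./2] equal to [v], this is the
   [k]-th derivative of [\sum_j (r j + s j * f ^+ p./2) * ('X^p - c%:P) ^+ j]
   multiplied by [f ^+ l], up to a power of [f]. *)
Definition stepanov_condition (p : nat) (f : {poly 'F_p}) (c v : 'F_p) (l J k : nat)
    (r s : 'I_J -> {poly 'F_p}) : {poly 'F_p} :=
  \sum_j (twisted_deriv 'F_p f l k (r j) + v *: twisted_deriv 'F_p f (l + p./2) k (s j))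
         * ('X - c%:P) ^+ j.

Lemma size_stepanov_condition (p : nat) (f : {poly 'F_p}) (c v : 'F_p) (l J k b d : nat)
    (r s : 'I_J -> {poly 'F_p}) :
  (size f <= d.+1)%N -> (forall j, size (r j) <= b)%N -> (forall j, size (s j) <= b)%N ->
  (k <= l)%N -> (size (stepanov_condition p f c v l J k r s) <= b + l * d + J)%N.
Proof.
move=> fd rb sb kl; rewrite /stepanov_condition.
apply: (leq_trans (size_sum _ _ _)); apply/bigmax_leqP => j _.
apply: leq_trans (size_polyMleq _ _) _; rewrite size_exp_XsubC addnS /=.
apply: leq_add (ltnW (ltn_ord j)).
apply: leq_trans (size_polyD _ _) _; rewrite geq_max.
apply/andP; split; last apply: leq_trans (size_scale_leq _ _) _.
  apply: leq_trans (size_twisted_deriv _ _ _ _ _ _ fd) _.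
  by rewrite leq_add // leq_mul2r kl orbT.
apply: leq_trans (size_twisted_deriv _ _ _ _ _ _ fd) _.
by rewrite leq_add // leq_mul2r kl orbT.
Qed.

Lemma stepanov_conditionB (p : nat) (f : {poly 'F_p}) (c v : 'F_p) (l J k : nat)
    (r s r' s' : 'I_J -> {poly 'F_p}) :
  stepanov_condition p f c v l J k (fun j => r j - r' j) (fun j => s j - s' j) =
  stepanov_condition p f c v l J k r s - stepanov_condition p f c v l J k r' s'.
Proof.
rewrite /stepanov_condition -sumrB; apply: eq_bigr => j _.
by rewrite !twisted_derivB scalerBr -mulrBl opprD addrACA.
Qed.

(** Pigeonhole over the finite field: there are [p ^ (2 J b)] choices of coefficients and fewer
    values of the conditions. Two choices with equal values are subtracted, the conditions being
    additive. *)
Lemma stepanov_solution (p : nat) (f : {poly 'F_p}) (c v : 'F_p) (l J b d : nat) :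
  prime p -> (size f <= d.+1)%N -> (l * (b + l * d + J) < (J * b).*2)%N ->
  exists r s : 'I_J -> {poly 'F_p},
    [/\ forall j, (size (r j) <= b)%N, forall j, (size (s j) <= b)%N,
        exists j, (r j != 0) || (s j != 0) &
        forall k, (k < l)%N -> stepanov_condition p f c v l J k r s = 0].
Proof.
move=> hp fd hcount; set b' := (b + l * d + J)%N in hcount.
pose poly_of (A : 'M['F_p]_(J, b)) j := rVpoly (row j A).
have size_poly_of A j : (size (poly_of A j) <= b)%N by exact: size_poly.
pose cond k (u : 'M['F_p]_(J, b) * 'M['F_p]_(J, b)) :=
  stepanov_condition p f c v l J k (poly_of u.1) (poly_of u.2).
pose phi u : 'M['F_p]_(l, b') := \matrix_(k < l) poly_rV (cond k u).
have /injectivePn[[A B] [[A' B'] neq eqphi]] : ~~ injectiveb phi.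
  apply/negP => /injectiveP/leq_card; rewrite card_prod !card_mx card_Fp //.
  by rewrite -expnD leq_exp2l ?prime_gt1 // addnn leqNgt hcount.
exists (fun j => poly_of A j - poly_of A' j), (fun j => poly_of B j - poly_of B' j).
have polyB C C' j : poly_of C j - poly_of C' j = poly_of (C - C') j.
  by rewrite /poly_of linearB -raddfB.
split=> [j|j||k kl]; rewrite ?polyB //.
- apply/existsP; apply: contraNT neq; rewrite negb_exists => /forallP h.
  have eqM C C' : (forall j, poly_of C j - poly_of C' j = 0) -> C = C'.
    move=> hC; apply/row_matrixP => j; apply: (can_inj rVpolyK).
    by apply/eqP; rewrite -subr_eq0; apply/eqP; exact: hC.
  apply/eqP; congr (_, _); apply: eqM => j.
    by move: (h j); rewrite negb_or !negbK => /andP[/eqP].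
  by move: (h j); rewrite negb_or !negbK => /andP[_ /eqP].
- rewrite stepanov_conditionB; apply/eqP; rewrite subr_eq0; apply/eqP.
  have := congr1 (fun M => rVpoly (row (Ordinal kl) M)) eqphi.
  rewrite !rowK !poly_rV_K //; apply: size_stepanov_condition => //; exact: ltnW.
Qed.

(** The right-hand side bounds the degree of [f ^+ l * G]; the factor [f ^+ l] pays for the powers
    of [f] lost in up to [l] differentiations. *)
Lemma stepanov_count (p : nat) (f : {poly 'F_p}) (a c v : 'F_p) (l J b d : nat) :
  prime p -> odd p -> size f = d.+1 -> mup a f = 1%N -> f.[c] != 0 ->
  (0 < b)%N -> (b.*2 + d <= p.+1)%N -> (l <= p)%N ->
  (l * (b + l * d + J) < (J * b).*2)%N ->
  (l * #|[set y | (f ^+ p./2).[y] == v]| <= l * d + (b + d * p./2 + p * J.-1))%N.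
Proof.
move=> hp op fd fa fc b0 hb lp hcount.
have := stepanov_solution p f c v l J b d hp _ hcount.
rewrite fd => /(_ (leqnn _))[r [s [rb sb [j0 nz] cond0]]].
pose Q : {poly 'F_p} := 'X^p - c%:P.
pose G := \sum_j (r j + s j * f ^+ p./2) * Q ^+ j.
have Q_monic : Q \is monic by rewrite monicXnsubC ?prime_gt0.
have f0 : f != 0 by rewrite -size_poly_eq0 fd.
have dQ j : (Q ^+ j)^`() = 0.
  rewrite deriv_exp derivB derivXn derivC subr0 -(mulr_natr 'X^_).
  by rewrite -polyC_natr (pcharf0 (pchar_Fp hp)) !(mulr0, mul0r) mul0rn.
(* If [G] vanished, then by induction on [j] the blocks below [j] are zero and those above are
   divisible by [Q ^+ j.+1]; hence [Q] divides block [j], which is zero by independence. *)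
have G0 : G != 0.
  apply/eqP => G0; suff h j : r j = 0 /\ s j = 0.
    by move: nz; have [-> ->] := h j0; rewrite eqxx.
  have [n] := ubnP (j : nat); elim: n j => // n IHn j /ltnSE jn.
  apply: (stepanov_independence p f (r j) (s j) a c b) => //.
    by rewrite fd addnS ltnS.
  rewrite -(@dvdp_mul2r _ (Q ^+ j)) ?expf_neq0 ?monic_neq0 // -/Q -exprS.
  have -> : (r j + s j * f ^+ p./2) * Q ^+ j =
            - \sum_(i | i != j) (r i + s i * f ^+ p./2) * Q ^+ i.
    by apply/eqP; rewrite -addr_eq0; apply/eqP; rewrite -[RHS]G0 /G [RHS](bigD1 j).
  rewrite dvdpNr; elim/big_ind: _ => [|u w|i ij]; [exact: dvdp0|exact: dvdp_add|].
  have [ij'|] := ltnP i j.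
    by have [-> ->] := IHn i (leq_trans ij' jn); rewrite mul0r addr0 mul0r dvdp0.
  rewrite leq_eqVlt eq_sym (inj_eq val_inj) (negPf ij) /= => ji.
  by rewrite dvdp_mull // dvdp_exp2l.
have sG : (size G <= b + d * p./2 + p * J.-1 + 1)%N.
  apply: (leq_trans (size_sum _ _ _)); apply/bigmax_leqP => j _.
  apply: leq_trans (size_polyMleq _ _) _.
  have sQ : (size (Q ^+ j) <= p * J.-1 + 1)%N.
    have jJ : (j <= J.-1)%N by rewrite -ltnS prednK ?ltn_ord // (leq_ltn_trans _ (ltn_ord j)).
    apply: leq_trans (size_exp_leq _ _) _.
    by rewrite size_XnsubC ?prime_gt0 //= addn1 ltnS leq_mul2l jJ orbT.
  have sh : (size (r j + s j * f ^+ p./2)%R <= b + d * p./2)%N.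
    apply: leq_trans (size_polyD _ _) _; rewrite geq_max.
    rewrite (leq_trans (rb j)) ?leq_addr //=.
    apply: leq_trans (size_polyMleq _ _) _.
    have := size_exp_leq f p./2; rewrite fd /=; have := sb j.
    by move: (size _) (size _) => x y; move: (d * _)%N; lia.
  move: sh sQ; move: (size _) (size _) => x y; move: (d * _)%N (p * _)%N; lia.
set N := #|_|.
have Groots : (l * N < size (f ^+ l * G)%R)%N.
  rewrite /N cardE; apply: card_multiple_roots.
  - by rewrite mulf_neq0 ?expf_neq0.
  - exact: enum_uniq.
  move=> y; rewrite mem_enum inE => /eqP gy.
  apply: (dvdp_exp_derivn _ p) => // [|k kl]; first exact: pchar_Fp.
  have -> : f ^+ l * G =
      \sum_j (f ^+ l * r j * Q ^+ j + f ^+ (l + p./2) * s j * Q ^+ j).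
    rewrite /G big_distrr /=; apply: eq_bigr => j _; rewrite exprD.
    by move: (f ^+ l) (f ^+ _) (Q ^+ j) => u w q; ring.
  rewrite raddf_sum horner_sum.
  (* Powers of [Q] have zero derivative, and at [y] one has [Q.[y] = y - c] and [f.[y] ^+ p./2 = v];
     these substitutions turn the derivative into a polynomial of low degree. *)
  transitivity (f.[y] ^+ (l - k) * (stepanov_condition p f c v l J k r s).[y]).
    rewrite /stepanov_condition horner_sum big_distrr; apply: eq_bigr => j _.
    have kl2 : (k <= l + p./2)%N by rewrite (leq_trans (ltnW kl)) ?leq_addr.
    rewrite /= derivnD !twisted_derivE ?dQ ?(ltnW kl) // -(addnBAC _ (ltnW kl)) exprD.
    have fy : f.[y] ^+ p./2 = v by rewrite -gy horner_exp.
    have yp : y ^+ p = y by exact: expr_Fp.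
    have Qy : Q.[y] = y - c by rewrite /Q hornerD hornerN hornerC hornerXn yp.
    move: (Q) Qy => q Qy.
    rewrite !(hornerXsubC, hornerD, hornerM, horner_exp, hornerZ) fy Qy.
    by move: (_ ^+ (l - k)) ((y - c) ^+ j) => u w; ring.
  by rewrite cond0 // horner0 mulr0.
have := leq_trans Groots (size_polyMleq _ _).
have := size_exp_leq f l; rewrite fd /=; move: sG.
move: (size _) (size _) => x z; move: (d * p./2)%N (p * _)%N (l * N)%N; lia.
Qed.

(** * Sums of the quadratic character *)

(** The quadratic character in Euler's form: for odd [p] the exponent is [(p - 1) / 2], so its level
    sets are the sets counted by [stepanov_count]. *)
Definition legendre (p : nat) (z : 'F_p) : int :=
  (z ^+ p./2 == 1)%:R - (z ^+ p./2 == -1)%:R.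

Lemma odd_prime_half (p : nat) : odd p -> p = (p./2.*2).+1.
Proof. by move=> op; rewrite -[LHS]odd_double_half op. Qed.

Lemma Fp_half_power (p : nat) (z : 'F_p) :
  prime p -> odd p -> z != 0 -> (z ^+ p./2 == 1) || (z ^+ p./2 == -1).
Proof.
move=> hp op z0; rewrite -sqrf_eq1 -exprM muln2; apply/eqP/(mulfI z0).
by rewrite mulr1 -exprS -odd_prime_half // expr_Fp.
Qed.

Lemma Fp_oner_neqN1 (p : nat) : prime p -> odd p -> 1 != -1 :> 'F_p.
Proof.
move=> hp op; rewrite -addr_eq0 -(natrD _ 1 1) -(dvdn_pcharf (pchar_Fp hp)).
rewrite dvdn_prime2 //; by apply: contraTneq op => ->.
Qed.

Lemma legendre0 (p : nat) : prime p -> odd p -> legendre p 0 = 0.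
Proof.
move=> hp op; rewrite /legendre.
have -> : 0 ^+ p./2 = 0 :> 'F_p by rewrite expr0n gtn_eqF ?half_gt0 ?prime_gt1.
by rewrite ![0 == _]eq_sym oppr_eq0 (negPf (oner_neq0 _)).
Qed.

Lemma legendre_eqN1 (p : nat) (z : 'F_p) :
  prime p -> odd p -> z != 0 -> legendre p z = 1 \/ legendre p z = -1.
Proof.
move=> hp op z0; rewrite /legendre; have n1 := negPf (Fp_oner_neqN1 p hp op).
case/orP: (Fp_half_power p z hp op z0) => /eqP->; rewrite eqxx ?n1; first by left.
by right; rewrite eq_sym n1.
Qed.

Lemma legendreM (p : nat) : prime p -> odd p -> {morph legendre p : x y / x * y}.
Proof.
move=> hp op x y; have n1 := negPf (Fp_oner_neqN1 p hp op).
have [->|x0] := eqVneq x 0; first by rewrite mul0r legendre0 // mul0r.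
have [->|y0] := eqVneq y 0; first by rewrite mulr0 legendre0 // mulr0.
rewrite /legendre exprMn; have n1' : (-1 == 1 :> 'F_p) = false by rewrite eq_sym.
case/orP: (Fp_half_power p x hp op x0) => /eqP->;
  case/orP: (Fp_half_power p y hp op y0) => /eqP->;
  by rewrite ?mulN1r ?mulrN1 ?opprK ?mul1r ?mulr1 ?eqxx ?n1 ?n1'.
Qed.

Lemma legendre1 (p : nat) : prime p -> odd p -> legendre p 1 = 1.
Proof. by move=> hp op; rewrite /legendre expr1n eqxx (negPf (Fp_oner_neqN1 p hp op)). Qed.

(** The count is divided by [l = 2h]: the term [p * h] gives [p / 2], and the terms of order [p],
    namely [p / 2], [d p / 2] and [p d], add up to [(3 d + 1) p / 2], where [p < 4 (h + 1)^2] makes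
    the quotient linear in [h]. *)
Lemma stepanov_arith (p d h N : nat) :
  odd p -> (4 * h ^ 2 <= p)%N -> (p < 4 * h.+1 ^ 2)%N -> (4 * d.+2 <= h)%N ->
  (h.*2 * N <= h.*2 * d + ((p.+1 - d)./2 + d * p./2 + p * (h + d)))%N ->
  (N.*2 + d <= p + (3 * d + 1) * (h.*2 + 6))%N.
Proof.
move=> op p1 p2 dh hN; rewrite leqNgt; apply/negP => hlt.
have ep : p = (1 + p./2 * 2)%N by rewrite muln2 -[LHS]odd_double_half op. 
move: hN.
have: (((p.+1 - d)./2) * 2 <= p.+1)%N.
  by rewrite muln2; have := odd_double_half (p.+1-d); move: (_./2); clear; lia.
move: (_./2) => b; rewrite -!muln2 in hlt *; move: p./2 ep => q ep hb hN.
have E1 : ((3 * d + 1) * p <= (3 * d + 1) * (4 * (h * h) + 8 * h + 3))%N.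
  by rewrite leq_mul2l; apply/orP; right; move: p2; clear; rewrite expnS expn1; lia.
have E2 : (h * (p + (3 * d + 1) * (h * 2 + 6) + 1) <= h * (N * 2 + d))%N.
  by rewrite leq_mul2l; apply/orP; right; move: hlt; clear; lia.
have E3 : (2 * d <= h * d)%N by rewrite leq_mul2r; apply/orP; right; move: dh; clear; lia.
have h0 : (1 < h)%N by move: dh; clear; lia.
move: E1 E2 E3 hN hb h0; rewrite ep; clear; lia.
Qed.
(** Since [2J] exceeds [l = 2h] by [2 (d + 1)], the surplus is [2 (d + 1) b], about [4 (d + 1) h^2];
    it outweighs [l (l d + J)], about [(4 d + 2) h^2]. *)
Lemma stepanov_parameters (p d h : nat) :
  (4 * h ^ 2 <= p)%N -> (4 * d.+2 <= h)%N ->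
  (h.*2 * ((p.+1 - d)./2 + h.*2 * d + (h + d).+1) < ((h + d).+1 * (p.+1 - d)./2).*2)%N.
Proof.
move=> p1 dh.
have: (p - d <= ((p.+1 - d)./2).*2)%N by have := odd_double_half (p.+1 - d); lia.
move: (_./2) => b; rewrite -!muln2 => hb.
have A : (d.+1 * (d + h * 2) < 2 * (h * h))%N.
  have : (4 * d.+1 * (d + h * 2) <= h * (d + h * 2))%N by rewrite leq_mul2r; lia.
  have : (h * d <= h * h)%N by rewrite leq_mul2l; lia.
  have : (0 < h * h)%N by rewrite muln_gt0; lia.
  clear; lia.
have B : (d.+1 * (4 * h ^ 2) <= d.+1 * (b * 2 + d))%N by rewrite leq_mul2l; lia.
rewrite expnS expn1 in B; move: A B; clear.
lia.
Qed.

Lemma card_set_sumn (T : finType) (P : pred T) : #|[set y | P y]| = (\sum_y P y)%N.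
Proof. by rewrite cardsE -sum1_card big_mkcond; apply: eq_bigr => y _; rewrite unfold_in; case: (P y). Qed.

Lemma legendre_sum_bound (p h : nat) (S : {set 'F_p}) :
  prime p -> odd p -> S != set0 -> (4 * h ^ 2 <= p)%N -> (p < 4 * h.+1 ^ 2)%N ->
  (4 * #|S|.+2 <= h)%N ->
  `|\sum_y \prod_(a in S) legendre p (y - a)| <= ((3 * #|S| + 1) * (h.*2 + 6))%:Z.
Proof.
move=> hp op /set0Pn[a aS] p1 p2 dh; set d := #|S|.
pose f : {poly 'F_p} := \prod_(a <- enum S) ('X - a%:P).
have fE y : f.[y] = \prod_(a in S) (y - a).
  by rewrite /f horner_prod big_enum; apply: eq_bigr => b _; rewrite hornerXsubC.
have rootf y : (f.[y] == 0) = (y \in S).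
  by rewrite -rootE /f root_prod_XsubC mem_enum.
have sf : size f = d.+1 by rewrite size_prod_XsubC -cardE.
have fa : mup a f = 1%N.
  by rewrite mu_prod_XsubC count_uniq_mem ?enum_uniq // mem_enum aS.
have ltdp : (d < p)%N by move: dh p1; rewrite -/d; clear; rewrite expnS expn1; nia.
have [c fc] : exists c, f.[c] != 0.
  have : (0 < #|~: S|)%N by rewrite cardsCs setCK card_Fp // subn_gt0.
  by case/card_gt0P => c; rewrite inE => cS; exists c; rewrite rootf.
pose N v := #|[set y | (f ^+ p./2).[y] == v]|.
have hN v : ((N v).*2 + d <= p + (3 * d + 1) * (h.*2 + 6))%N.
  apply: stepanov_arith => //.
  have := stepanov_count p f a c v h.*2 (h + d).+1 (p.+1 - d)./2 d.
  apply => //; last exact: stepanov_parameters.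
  - by rewrite half_gt0; move: ltdp; lia.
  - by have := odd_double_half (p.+1 - d); move: ltdp; lia.
  - by move: p1 dh; clear; rewrite expnS expn1 -muln2; nia.
have n1 := Fp_oner_neqN1 p hp op.
(* With the sum of the two counts fixed, an upper bound on either is a lower bound on the other, so
   the two upper bounds control the sum in absolute value. *)
have Nsum : (N 1%R + N (-1)%R + d = p)%N.
  transitivity (\sum_(y : 'F_p) 1)%N; last by rewrite sum1_card card_Fp.
  rewrite /N /d.
  have -> : #|S| = #|[set y | y \in S]| by apply: eq_card => y; rewrite inE.
  rewrite !card_set_sumn -!big_split; apply: eq_bigr => y _ /=.
  rewrite horner_exp -rootf; have [->|fy] := eqVneq f.[y] 0.
    rewrite expr0n gtn_eqF ?half_gt0 ?prime_gt1 //.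
    by rewrite ![0%R == _]eq_sym oppr_eq0 (negPf (oner_neq0 _)).
  case/orP: (Fp_half_power p _ hp op fy) => /eqP->; rewrite eqxx ?(negPf n1) //.
  by rewrite eq_sym (negPf n1).
have -> : \sum_y \prod_(a in S) legendre p (y - a) = (N 1)%:Z - (N (-1))%:Z.
  rewrite /N !card_set_sumn -!natz !natr_sum -sumrB; apply: eq_bigr => y _.
  by rewrite horner_exp fE -(big_morph _ (legendreM p hp op) (legendre1 p hp op)).
move: (hN 1) (hN (-1)) Nsum; rewrite -/d; move: (N 1) (N (-1)).
move: ((3 * d + 1) * _)%N => B x y; lia.
Qed.

(** * Prescribed values of the quadratic character *)

Lemma prod_1add (R : comNzRingType) (T : finType) (D : {set T}) (F : T -> R) :
  \prod_(a in D) (1 + F a) = \sum_(S in powerset D) \prod_(a in S) F a.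
Proof.
transitivity (\prod_a ((if a \in D then F a else 0) + 1)).
  rewrite big_mkcond; apply: eq_bigr => a _.
  by case: ifP => _; rewrite ?add0r // addrC.
rewrite bigA_distr [RHS]big_mkcond; apply: eq_bigr => S _.
rewrite powersetE -big_mkcond; case: ifPn => [/subsetP SD | /subsetPn[a aS aD]].
  by apply: eq_bigr => a aS; rewrite SD.
by rewrite (bigD1 a) //= (negPf aD) mul0r.
Qed.

Lemma half_sqrt (p : nat) : exists h, (4 * h ^ 2 <= p < 4 * h.+1 ^ 2)%N.
Proof.
elim: p => [|p [h /andP[h1 h2]]]; first by exists 0%N.
have [lt|ge] := ltnP p.+1 (4 * h.+1 ^ 2); first by exists h; rewrite lt (leq_trans h1).
exists h.+1; rewrite ge (leq_ltn_trans h2) // ltn_mul2l /= ltn_sqr; lia.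
Qed.

(** The hypothesis amounts to [h >= 2 (k + 2) 2^k]. For [k > 0] the error is then at most
    [3 h^2 + 9 h] and [(k + 1) 2^k] is below [h / 2], so [h >= 12] keeps the total under
    [4 h^2 <= p]. *)
Lemma pattern_arith (p k h : nat) :
  (16 * (k.+2 * 2 ^ k) ^ 2 <= p)%N -> (4 * h ^ 2 <= p < 4 * h.+1 ^ 2)%N ->
  (0 < k -> 4 * k.+2 <= h)%N /\
  ((2 ^ k - 1) * ((3 * k + 1) * (h.*2 + 6)) + k.+1 * 2 ^ k < p)%N.
Proof.
move=> hk /andP[p1 p2].
have hW : (2 * (k.+2 * 2 ^ k) <= h)%N.
  rewrite -ltnS -(@ltn_sqr _ h.+1) -(@ltn_pmul2l 4) //.
  by apply: leq_ltn_trans p2; apply: leq_trans hk; rewrite expnMn mulnA.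
(* For [k = 0] the factor [2 ^ k - 1] removes the error term, and [h >= 12] need not hold. *)
case: k hk hW => [|k] hk hW.
  by split=> //; rewrite expn0 subnn mul0n add0n mul1n; apply: leq_trans hk.
have e1 : (1 <= 2 ^ k)%N by rewrite expn_gt0.
rewrite expnS in hW *; move: (2 ^ k)%N e1 hW => e e1 hW; split=> [_|].
  have : (k.+3 * 1 <= k.+3 * e)%N by rewrite leq_mul2l.
  by move: hW; clear; lia.
have h12 : (12 <= h)%N.
  have : (k.+3 * 1 <= k.+3 * e)%N by rewrite leq_mul2l.
  by move: hW; clear; lia.
have A1 : ((2 * e - 1) * ((3 * k.+1 + 1) * (h.*2 + 6)) <= 3 * (k.+3 * (2 * e)) * (h.*2 + 6))%N.
  rewrite mulnA leq_mul2r; apply/orP; right; clear; move: e => [|e]; nia.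
have A2 : (3 * (2 * (k.+3 * (2 * e))) * (h.*2 + 6) <= 3 * h * (h.*2 + 6))%N.
  by rewrite leq_mul2r leq_mul2l hW !orbT.
have A3 : (12 * h <= h * h)%N by rewrite leq_mul2r h12 orbT.
move: p1 A1 A2 A3 hW; rewrite expnS expn1 -muln2; move: ((2 * e - 1) * _)%N => Z.
move: e1 h12; clear; lia.
Qed.

Lemma legendre_pattern (p : nat) (D : {set 'F_p}) (eps : 'F_p -> int) (x : 'F_p) :
  prime p -> odd p -> (forall a, eps a = 1 \/ eps a = -1) ->
  (16 * (#|D|.+2 * 2 ^ #|D|) ^ 2 <= p)%N ->
  exists y, [/\ y != x, y \notin D & forall a, a \in D -> legendre p (y - a) = eps a].
Proof.
move=> hp op heps; set k := #|D| => hk.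
have [h hh] := half_sqrt p.
have [dh lt_p] := pattern_arith p k h hk hh; have /andP[p1 p2] := hh.
set B := ((3 * k + 1) * (h.*2 + 6))%N in lt_p.
pose good y := [&& y != x, y \notin D & [forall a in D, legendre p (y - a) == eps a]].
have [/existsP[y /and3P[yx yD /forall_inP hy]]|] := boolP [exists y, good y].
  by exists y; split=> // a aD; apply/eqP; exact: hy.
rewrite negb_exists => /forallP bad.
(* Every factor is 0, 1 or 2, with 1 only at [y = a]. Outside [x |: D] a wrong sign gives a factor
   0, so if no [y] is good, only the at most [k.+1] points of [x |: D] contribute. *)
pose W y := \prod_(a in D) (1 + eps a * legendre p (y - a)).
have legN1 z : legendre p z = 0 \/ legendre p z = 1 \/ legendre p z = -1.
  have [->|z0] := eqVneq z 0; first by left; exact: legendre0.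
  by right; exact: legendre_eqN1.
have W_le y : W y <= (if y \in x |: D then (2 ^ k)%:Z else 0).
  have [_|yxD] := boolP (y \in x |: D).
    have -> : (2 ^ k)%:Z = \prod_(a in D) 2%:Z by rewrite prodr_const -!natz natrX.
    apply: ler_prod => a _.
    by case: (heps a) (legN1 (y - a)) => -> [-> | [-> | ->]]; lia.
  move: (bad y) yxD; rewrite /good !inE negb_or => + /andP[yx yD].
  rewrite yx yD /= => /forall_inPn[a aD]; rewrite /W (bigD1 a) //=.
  have ya0 : y - a != 0 by rewrite subr_eq0; apply: contraNneq yD => ->.
  by case: (heps a) (legendre_eqN1 p (y - a) hp op ya0) => -> [-> | ->]; rewrite ?eqxx //= mul0r.
have sumW_le : \sum_y W y <= (k.+1 * 2 ^ k)%:Z.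
  apply: le_trans (ler_sum _ (fun y _ => W_le y)) _.
  rewrite -big_mkcond sumr_const /= -mulr_natl natz -PoszM lez_nat leq_mul2r.
  by rewrite cardsU1 -/k; case: (x \notin D) => /=; rewrite ?leqnn ?leqnSn orbT.
(* The empty subset contributes [p]; each of the other [2 ^ k - 1] subsets contributes a character
   sum times a sign, at least [- B]. *)
have sumW_ge : p%:Z - ((2 ^ k - 1) * B)%:Z <= \sum_y W y.
  have -> : \sum_y W y = \sum_(S in powerset D) \sum_y \prod_(a in S) (eps a * legendre p (y - a)).
    by rewrite exchange_big; apply: eq_bigr => y _; exact: prod_1add.
  rewrite (bigD1 set0) ?powersetE ?sub0set //=.
  rewrite (eq_bigr (fun=> 1)) => [|y _]; last by rewrite big_set0.
  rewrite sumr_const card_Fp // natz lerD2l -[X in _ <= X]opprK lerN2 -sumrN.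
  apply: le_trans (_ : \sum_(S in powerset D | S != set0) B%:Z <= _); last first.
    rewrite sumr_const -mulr_natl natz -PoszM lez_nat leq_mul2r; apply/orP; right.
    rewrite (eq_card (_ : _ =i powerset D :\ set0)) => [|S]; last by rewrite unfold_in !inE andbC.
    by rewrite cardsDS ?sub1set ?powersetE ?sub0set // card_powerset cards1.
  apply: ler_sum => S /andP[]; rewrite powersetE => SD S0.
  apply: le_trans (ler_norm _) _; rewrite normrN.
  have -> : \sum_y \prod_(a in S) (eps a * legendre p (y - a)) =
            (\prod_(a in S) eps a) * \sum_y \prod_(a in S) legendre p (y - a).
    by rewrite big_distrr; apply: eq_bigr => y _; rewrite big_split.
  have Sk : (#|S| <= k)%N := subset_leq_card SD.
  have S_gt0 : (0 < #|S|)%N by rewrite card_gt0.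
  rewrite normrM normr_prod big1 ?mul1r => [|a _]; last by case: (heps a) => ->.
  apply: le_trans (legendre_sum_bound p h S hp op S0 p1 p2 _) _.
    by apply: leq_trans (dh (leq_trans S_gt0 Sk)); rewrite leq_mul2l ltnS.
  by rewrite lez_nat /B leq_mul2r leq_add2r leq_mul2l Sk !orbT.
by have := le_trans sumW_ge sumW_le; move: lt_p; lia.
Qed.

(** * Teaching sets *)

Lemma legendre_square (p : nat) (w : 'F_p) : prime p -> p = 3 %[mod 4] ->
  (w != 0) && [exists z : 'F_p, z ^+ 2 == w] = (legendre p w == 1).
Proof.
move=> hp p3; have op : odd p by rewrite (divn_eq p 4) p3 oddD oddM andbF.
have [->|w0] := eqVneq w 0; first by rewrite legendre0.
have n1 := negPf (Fp_oner_neqN1 p hp op).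
have -> : (legendre p w == 1) = (w ^+ p./2 == 1).
  rewrite /legendre; case/orP: (Fp_half_power p w hp op w0) => /eqP->.
    by rewrite eqxx n1.
  by rewrite eqxx (eq_sym (-1)) n1.
apply/existsP/eqP => [[z /eqP zw]|hw].
  have z0 : z != 0 by apply: contraNneq w0 => z0; rewrite -zw z0 expr0n.
  rewrite -zw -exprM mulnC muln2; apply: (mulfI z0).
  by rewrite mulr1 -exprS -odd_prime_half // expr_Fp.
(* Here [q = (p - 3) / 4], and the square root of [w] is [w ^+ q.+1], since its square is
   [w ^+ p./2 * w]. *)
have [q pq] : exists q, p./2 = q.*2.+1.
  exists (p %/ 4)%N; have := odd_prime_half p op; have := divn_eq p 4; rewrite p3.
  by move: (p %/ 4)%N p./2; lia.
exists (w ^+ q.+1); apply/eqP; rewrite -exprM muln2 doubleS exprSr -pq hw.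
exact: mul1r.
Qed.

Lemma qr_edgeE (p : nat) (x y : 'I_p) : prime p -> p = 3 %[mod 4] ->
  qr_edge p x y = (legendre p ((x : nat)%:R - (y : nat)%:R) == 1).
Proof.
by move=> hp p3; rewrite /qr_edge quad_residueE // legendre_square // rmorphB /= -!pmulrn.
Qed.

Lemma natr_Fp_inj (p : nat) : prime p -> injective (fun x : 'I_p => (x : nat)%:R : 'F_p).
Proof.
move=> hp x y /(congr1 (@nat_of_ord _)); rewrite !val_Fp_nat // !modn_small //; exact: val_inj.
Qed.

(** No vertex lies in its own out-neighbourhood, so two vertices with equal out-neighbourhoods would
    have no edge between them. *)
Lemma tournament_concept_inj (V : finType) (e : rel V) :
  is_tournament e -> injective (out_nbrs e).
Proof.
move=> [irr tot] x y exy; apply/eqP; apply: contraT => nxy.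
have hx : e y x = false by rewrite -[RHS](irr x); move/setP/(_ x): exy; rewrite !inE.
have hy : e x y = false by rewrite -[RHS](irr y); move/setP/(_ y): exy; rewrite !inE.
by have := tot x y nxy; rewrite hx hy.
Qed.

Lemma qr_teaching_set_large (p : nat) (x : 'I_p) (D : {set 'I_p}) :
  prime p -> p = 3 %[mod 4] ->
  teaching_set (concept_class (qr_edge p)) (out_nbrs (qr_edge p) x) D ->
  (p < 16 * (#|D|.+2 * 2 ^ #|D|) ^ 2)%N.
Proof.
move=> hp p3 teach; rewrite ltnNge; apply/negP => hD.
have op : odd p by rewrite (divn_eq p 4) p3 oddD oddM andbF.
pose toF (a : 'I_p) : 'F_p := (a : nat)%:R.
have toF_inj : injective toF := natr_Fp_inj p hp.
(* Membership in the concept is used instead of the character, which is 0 at [toF x]; there the sign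
   is -1, as [x] is not in its own concept. *)
pose eps b : int := if b \in toF @: out_nbrs (qr_edge p) x then 1 else -1.
have heps b : eps b = 1 \/ eps b = -1 by rewrite /eps; case: ifP; [left|right].
have := legendre_pattern p (toF @: D) eps (toF x) hp op heps.
rewrite card_imset // => /(_ hD)[y' [yx _ hy]].
have y'p : (y' < p)%N by rewrite -[X in (_ < X)%N](Fp_cast hp).
pose y : 'I_p := Ordinal y'p.
have toFy : toF y = y' by rewrite /toF /= natr_Zp.
have neq : out_nbrs (qr_edge p) y != out_nbrs (qr_edge p) x.
  rewrite (inj_eq (tournament_concept_inj _ _ (qr_edge_tournament hp p3))).
  by apply: contraNneq yx => <-; rewrite toFy.
have := forall_inP teach (out_nbrs (qr_edge p) y).
rewrite !inE neq imset_f // => /(_ isT)/exists_inP[a aD] /negP; apply; apply/eqP.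
have := hy _ (imset_f toF aD); rewrite /eps mem_imset // => hya.
rewrite [in RHS]inE qr_edgeE // -/(toF y) -/(toF a) toFy hya.
by case: ifP.
Qed.

(** The minimum is one of the values or the seed, so the seed must be checked too. *)
Lemma bigmin_inP (T : finType) (P : pred T) (F : T -> nat) (n : nat) (Q : nat -> Prop) :
  Q n -> (forall i, P i -> Q (F i)) -> Q (\big[minn/n]_(i | P i) F i).
Proof. by move=> Qn QF; elim/big_ind: _ => // a b Qa Qb; rewrite /minn; case: ifP. Qed.

Lemma qr_TDmin_large (p : nat) : prime p -> p = 3 %[mod 4] ->
  let k := TDmin (concept_class (qr_edge p)) in (p < 16 * (k.+2 * 2 ^ k) ^ 2)%N.
Proof.
move=> hp p3 /=.
(* The case of the seed, which is [#|'I_p| = p] for both nested minima. *)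
have seed : (p < 16 * (p.+2 * 2 ^ p) ^ 2)%N.
  have : (p.+2 * 1 <= p.+2 * 2 ^ p)%N by rewrite leq_mul2l expn_gt0.
  by rewrite expnS expn1; move: (p.+2 * 2 ^ p)%N => e; nia.
pose Q k := (p < 16 * (k.+2 * 2 ^ k) ^ 2)%N.
apply: (bigmin_inP _ _ _ _ Q) => [|_ /imsetP[x _ ->]]; first by rewrite card_ord.
apply: (bigmin_inP _ _ _ _ Q) => [|D]; first by rewrite card_ord.
exact: qr_teaching_set_large.
Qed.

(** * Passage to logarithms *)

Lemma log2_bound (R : realType) (p k : nat) : (2 < p)%N ->
  k%:R <= 1 / 2 * log2 (p%:R : R) - log2 (log2 (p%:R : R)) - 1 ->
  (16 * (k.+2 * 2 ^ k) ^ 2 <= p)%N.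
Proof.
move=> p2 hk; have k0 : 0 <= k%:R :> R by [].
have p2R : 2 < p%:R :> R by rewrite (ltr_nat R 2 p).
have ln2 : 0 < ln (2 : R) by apply: ln_gt0; rewrite ltr1n.
have log2_mono (x y : R) : 0 < x -> x < y -> log2 x < log2 y.
  by move=> x0 xy; rewrite /log2 ltr_pM2r ?invr_gt0 // ltr_ln ?posrE // (lt_trans x0).
have log22 : log2 2 = 1 :> R by rewrite /log2 divff // gt_eqF.
set L := log2 p%:R in hk.
have L1 : 1 < L by rewrite -log22; apply: log2_mono.
have : log2 1 < log2 L by apply: log2_mono.
rewrite {1}/log2 ln1 mul0r => L0.
(* A bootstrap: [k >= 0] and [log2 L > 0] force [L > 2], hence [log2 L > 1], and the hypothesis then
   improves to [2 (k + 2) <= L]. *)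
have L2 : 2 < L by lra.
have : log2 2 < log2 L by apply: log2_mono.
rewrite log22 => LL1.
have kL : 2 * (k.+2)%:R <= L by rewrite -addn2 natrD; lra.
(* The hypothesis doubled and exponentiated; replacing [L] by the smaller [2 (k + 2)] then yields
   the constant 16. *)
have sq : (2 ^+ k.+1 * L) ^+ 2 <= p%:R.
  have pos : 0 < 2 ^+ k.+1 * L by rewrite mulr_gt0 ?exprn_gt0 //; lra.
  rewrite -ler_ln ?posrE ?exprn_gt0 //; last by lra.
  rewrite lnXn // lnM ?posrE ?exprn_gt0 //; last by lra.
  rewrite lnXn // -[ln p%:R](divfK (_ : ln 2 != 0)) ?gt_eqF //.
  rewrite -[ln L](divfK (_ : ln 2 != 0)) ?gt_eqF // -/(log2 L) -/(log2 p%:R) -/L.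
  rewrite -[_ *+ k.+1]mulr_natr -[_ *+ 2]mulr_natr -addn1 natrD; nra.
rewrite -(ler_nat R); apply: le_trans sq.
have -> : (16 * (k.+2 * 2 ^ k) ^ 2)%N%:R = (2 ^+ k.+1 * (2 * (k.+2)%:R)) ^+ 2 :> R.
  by rewrite !(natrX, natrM) [2 ^+ k.+1]exprS; ring.
have e0 : 0 < 2 ^+ k.+1 :> R by exact: exprn_gt0.
by rewrite lerXn2r ?ler_pM2l // nnegrE mulr_ge0 //; lra.
Qed.

Theorem theorem4 (R : realType) (p : nat) (hp : prime p) (h3 : p = 3 %[mod 4]) :
  (TDmin (concept_class (qr_edge p)))%:R >
    1 / 2 * log2 (p%:R : R) - log2 (log2 (p%:R : R)) - 1.
Proof.
rewrite ltNge; apply/negP => /log2_bound hle.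
have p2 : (2 < p)%N by move: hp h3; case: p {hle} => [|[|[|p]]].
by have /= := qr_TDmin_large p hp h3; rewrite ltnNge hle.
Qed.
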